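(* (Sliding.) Let $\mathbf C$ be a cancellative atomic Markov category with conditionals. Let $f:X\otimes W'\to Y\otimes W$ and $g:W\to W'$. If $f$ is non-signalling from $W'$ to $W$, then $(\mathrm{id}_Y\otimes g)\circ f:X\otimes W'\to Y\otimes W'$ and $f\circ(\mathrm{id}_X\otimes g):X\otimes W\to Y\otimes W$ are traceable, and $$\mathbf{tr}^{W'}\big((\mathrm{id}_Y\otimes g)\circ f\big)=\mathbf{tr}^{W}\big(f\circ(\mathrm{id}_X\otimes g)\big).$$
   Context: A Markov category is a symmetric monoidal category $(\mathbf C,\otimes,I)$ in which every object $X$ carries a commutative comonoid $\Delta_X:X\to X\otimes X$, $\mathrm{del}_X:X\to I$, compatible with $\otimes$, and every $f:X\to Y$ satisfies $\mathrm{del}_Y\circ f=\mathrm{del}_X$. Naturality of $\Delta$ is not assumed. Coherence isomorphisms are suppressed. $\mathbf C$ has conditionals if for every $f:A\to X\otimes Y$ there is $f|_X:X\otimes A\to Y$ with $f=(\mathrm{id}_X\otimes f|_X)\circ(\Delta_X\otimes\mathrm{id}_A)\circ\big(((\mathrm{id}_X\otimes\mathrm{del}_Y)\circ f)\otimes\mathrm{id}_A\big)\circ\Delta_A$. For $p:A\to X$ and $f_1,f_2:W\otimes X\to Y$, write $f_1=_pf_2$ if $(f_1\otimes\mathrm{id}_X)\circ(\mathrm{id}_W\otimes(\Delta_X\circ p))=(f_2\otimes\mathrm{id}_X)\circ(\mathrm{id}_W\otimes(\Delta_X\circ p))$. For $p:A\to X$, $q:B\to X$ write $p\ll q$ if for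 all $W,Y$ and $f_1,f_2:W\otimes X\to Y$, $f_1=_qf_2$ implies $f_1=_pf_2$. $p:A\to X$ is atomic if $\Delta_X\circ p\ll p\otimes p$; $\mathbf C$ is atomic if all its morphisms are. An object $W$ is cancellable if $\mathrm{del}_W\otimes f_1=\mathrm{del}_W\otimes f_2$ implies $f_1=f_2$ for all parallel $f_1,f_2$; $\mathbf C$ is cancellative if all objects are cancellable. A morphism $f:X\otimes W'\to Y\otimes W$ is non-signalling (from $W'$ to $W$) if there is $f_s:X\to W$ with $(\mathrm{del}_Y\otimes\mathrm{id}_W)\circ f=f_s\otimes\mathrm{del}_{W'}$. A disintegration of $f$ is a pair $f_s:X\to W$, $f_p:X\otimes W\otimes W'\to Y$ with $f=(f_p\otimes\mathrm{id}_W)\circ(\mathrm{id}_{X\otimes W}\otimes\mathrm{swap}_{W,W'})\circ(s\otimes\mathrm{id}_{W'})$, where $s=(\mathrm{id}_X\otimes(\Delta_W\circ f_s))\circ\Delta_X:X\to X\otimes W\otimes W$. In a Markov category with conditionals, $f$ is non-signalling iff it has a disintegration. $f:X\otimes W\to Y\otimes W$ is called traceable (with respect to $W$) if it is non-signalling from the input $W$ to the output $W$; its causal trace is $\mathbf{tr}^W(f)=f_p\circ s:X\to Y$ for any disintegration (with $W'=W$); under the stated assumptions on $\mathbf C$ this does not depend on the choice of disintegration. *)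

(* Defs.v *)
(* Self-contained over Stdlib.  Indefinite description is used only to pick
   the disintegration that computes a causal trace. *)
From Stdlib Require Import ssreflect IndefiniteDescription.

Set Implicit Arguments.
Unset Strict Implicit.
Unset Printing Implicit Defensive.

Declare Scope ob_scope.
Delimit Scope ob_scope with ob.
Declare Scope mor_scope.
Delimit Scope mor_scope with mor.
Global Open Scope mor_scope.

Record category := Category {
  Ob :> Type;
  Hom : Ob -> Ob -> Type;
  idm : forall X : Ob, Hom X X;
  comp : forall X Y Z : Ob, Hom Y Z -> Hom X Y -> Hom X Z;
  comp1m : forall (X Y : Ob) (f : Hom X Y), comp (idm Y) f = f;
  compm1 : forall (X Y : Ob) (f : Hom X Y), comp f (idm X) = f;
  compA : forall (X Y Z T : Ob) (h : Hom Z T) (g : Hom Y Z) (f : Hom X Y),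
    comp h (comp g f) = comp (comp h g) f
}.
Bind Scope ob_scope with Ob.
Bind Scope mor_scope with Hom.
Arguments Hom {c} (X Y)%_ob.
Arguments idm {c} X%_ob.
Arguments comp {c X Y Z} (g f)%_mor : rename.
Notation "X ~> Y" := (Hom X Y) (at level 90, no associativity) : type_scope.
Notation "g ∘ f" := (comp g f) (at level 50, left associativity) : mor_scope.

(* Not assumed strict: the associator and the unitors are explicit. *)
Record symmetric_monoidal_category := SymmetricMonoidalCategory {
  underlying_category :> category;
  tens : underlying_category -> underlying_category -> underlying_category;
  unit_ob : underlying_category;
  tensm : forall A B C D : underlying_category,
    (A ~> B) -> (C ~> D) -> (tens A C ~> tens B D);
  assoc : forall A B C : underlying_category,
    tens (tens A B) C ~> tens A (tens B C);
  assocV : forall A B C : underlying_category,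
    tens A (tens B C) ~> tens (tens A B) C;
  lunit : forall A : underlying_category, tens unit_ob A ~> A;
  lunitV : forall A : underlying_category, A ~> tens unit_ob A;
  runit : forall A : underlying_category, tens A unit_ob ~> A;
  runitV : forall A : underlying_category, A ~> tens A unit_ob;
  swap : forall A B : underlying_category, tens A B ~> tens B A;
  tensm1 : forall A B : underlying_category,
    tensm (idm A) (idm B) = idm (tens A B);
  tensm_comp : forall (A B C A' B' C' : underlying_category)
      (g : B ~> C) (f : A ~> B) (g' : B' ~> C') (f' : A' ~> B'),
    tensm (g ∘ f) (g' ∘ f') = tensm g g' ∘ tensm f f';
  assocK : forall A B C : underlying_category,
    assocV A B C ∘ assoc A B C = idm _;
  assocVK : forall A B C : underlying_category,
    assoc A B C ∘ assocV A B C = idm _;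
  lunitK : forall A : underlying_category, lunitV A ∘ lunit A = idm _;
  lunitVK : forall A : underlying_category, lunit A ∘ lunitV A = idm _;
  runitK : forall A : underlying_category, runitV A ∘ runit A = idm _;
  runitVK : forall A : underlying_category, runit A ∘ runitV A = idm _;
  swapK : forall A B : underlying_category, swap B A ∘ swap A B = idm _;
  assoc_nat : forall (A B C A' B' C' : underlying_category)
      (f : A ~> A') (g : B ~> B') (h : C ~> C'),
    assoc A' B' C' ∘ tensm (tensm f g) h
    = tensm f (tensm g h) ∘ assoc A B C;
  lunit_nat : forall (A B : underlying_category) (f : A ~> B),
    lunit B ∘ tensm (idm unit_ob) f = f ∘ lunit A;
  runit_nat : forall (A B : underlying_category) (f : A ~> B),
    runit B ∘ tensm f (idm unit_ob) = f ∘ runit A;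
  swap_nat : forall (A B A' B' : underlying_category)
      (f : A ~> A') (g : B ~> B'),
    swap A' B' ∘ tensm f g = tensm g f ∘ swap A B;
  pentagon : forall A B C D : underlying_category,
    assoc A B (tens C D) ∘ assoc (tens A B) C D
    = tensm (idm A) (assoc B C D) ∘ assoc A (tens B C) D
      ∘ tensm (assoc A B C) (idm D);
  triangle : forall A B : underlying_category,
    tensm (idm A) (lunit B) ∘ assoc A unit_ob B = tensm (runit A) (idm B);
  hexagon : forall A B C : underlying_category,
    assoc B C A ∘ swap A (tens B C) ∘ assoc A B C
    = tensm (idm B) (swap A C) ∘ assoc B A C ∘ tensm (swap A B) (idm C);
  swap_unit : forall A : underlying_category,
    lunit A ∘ swap A unit_ob = runit A
}.
Arguments tens {s} (X Y)%_ob : rename.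
Arguments unit_ob {s}.
Arguments tensm {s A B C D} (f g)%_mor : rename.
Arguments assoc {s} (A B C)%_ob.
Arguments assocV {s} (A B C)%_ob.
Arguments lunit {s} A%_ob.
Arguments lunitV {s} A%_ob.
Arguments runit {s} A%_ob.
Arguments runitV {s} A%_ob.
Arguments swap {s} (A B)%_ob.
Notation "X ⊗ Y" := (tens X Y) (at level 40, left associativity) : ob_scope.
Notation "f ⊗ g" := (tensm f g) (at level 40, left associativity) : mor_scope.

(* The middle-four swap of the inner factors A' and B. *)
Definition interchange (C : symmetric_monoidal_category) (A B A' B' : C) :
    (A ⊗ A') ⊗ (B ⊗ B') ~> (A ⊗ B) ⊗ (A' ⊗ B') :=
  assocV A B (A' ⊗ B')
  ∘ (idm A ⊗ (assoc B A' B' ∘ (swap A' B ⊗ idm B') ∘ assocV A' B B'))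
  ∘ assoc A A' (B ⊗ B').
Arguments interchange {C} (A B A' B')%_ob.

Record markov_category := MarkovCategory {
  underlying_smc :> symmetric_monoidal_category;
  copy : forall X : underlying_smc, X ~> X ⊗ X;
  del : forall X : underlying_smc, X ~> unit_ob;
  copy_assoc : forall X : underlying_smc,
    assoc X X X ∘ (copy X ⊗ idm X) ∘ copy X = (idm X ⊗ copy X) ∘ copy X;
  copy_lunit : forall X : underlying_smc,
    lunit X ∘ (del X ⊗ idm X) ∘ copy X = idm X;
  copy_runit : forall X : underlying_smc,
    runit X ∘ (idm X ⊗ del X) ∘ copy X = idm X;
  copy_comm : forall X : underlying_smc, swap X X ∘ copy X = copy X;
  copy_tens : forall X Y : underlying_smc,
    copy (X ⊗ Y) = interchange X Y X Y ∘ (copy X ⊗ copy Y);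
  del_tens : forall X Y : underlying_smc,
    del (X ⊗ Y) = lunit unit_ob ∘ (del X ⊗ del Y);
  copy_unit : copy unit_ob = lunitV unit_ob;
  del_unit : del unit_ob = idm unit_ob;
  del_nat : forall (X Y : underlying_smc) (f : X ~> Y), del Y ∘ f = del X
}.
Arguments copy {m} X%_ob.
Arguments del {m} X%_ob.

Section MarkovNotions.
Context {C : markov_category}.

Definition is_conditional (A X Y : C) (f : A ~> X ⊗ Y) (c : X ⊗ A ~> Y) : Prop :=
  f = (idm X ⊗ c) ∘ assoc X X A ∘ (copy X ⊗ idm A)
      ∘ ((runit X ∘ (idm X ⊗ del Y) ∘ f) ⊗ idm A) ∘ copy A.

(* f1 =_p f2, with the extra input W of f1 and f2 on the left. *)
Definition ase (A W X Y : C) (p : A ~> X) (f1 f2 : W ⊗ X ~> Y) : Prop :=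
  (f1 ⊗ idm X) ∘ assocV W X X ∘ (idm W ⊗ (copy X ∘ p))
  = (f2 ⊗ idm X) ∘ assocV W X X ∘ (idm W ⊗ (copy X ∘ p)).

(* p << q; note that p and q need not have the same domain. *)
Definition abs_continuous (A B X : C) (p : A ~> X) (q : B ~> X) : Prop :=
  forall (W Y : C) (f1 f2 : W ⊗ X ~> Y), ase q f1 f2 -> ase p f1 f2.

Definition atomic_morphism (A X : C) (p : A ~> X) : Prop :=
  abs_continuous (copy X ∘ p) (p ⊗ p).

Definition cancellable (W : C) : Prop :=
  forall (A B : C) (f1 f2 : A ~> B), del W ⊗ f1 = del W ⊗ f2 -> f1 = f2.

Definition non_signalling (X W' Y W : C) (f : X ⊗ W' ~> Y ⊗ W) : Prop :=
  exists fs : X ~> W,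
    lunit W ∘ (del Y ⊗ idm W) ∘ f = runit W ∘ (fs ⊗ del W').

(* The morphism s : X -> X W W of a disintegration (fs, fp). *)
Definition copied_marginal (X W : C) (fs : X ~> W) : X ~> X ⊗ W ⊗ W :=
  assocV X W W ∘ (idm X ⊗ (copy W ∘ fs)) ∘ copy X.

Definition is_disintegration (X W' Y W : C) (f : X ⊗ W' ~> Y ⊗ W)
    (fs : X ~> W) (fp : X ⊗ W ⊗ W' ~> Y) : Prop :=
  f = (fp ⊗ idm W) ∘ assocV (X ⊗ W) W' W ∘ (idm (X ⊗ W) ⊗ swap W W')
      ∘ assoc (X ⊗ W) W W' ∘ (copied_marginal fs ⊗ idm W').

(* Here the input wire and the output wire carry the same object W. *)
Definition traceable (X W Y : C) (f : X ⊗ W ~> Y ⊗ W) : Prop :=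
  non_signalling f.

Definition is_causal_trace (X W Y : C) (f : X ⊗ W ~> Y ⊗ W) (t : X ~> Y) : Prop :=
  exists (fs : X ~> W) (fp : X ⊗ W ⊗ W ~> Y),
    is_disintegration f fs fp /\ t = fp ∘ copied_marginal fs.

End MarkovNotions.

Definition has_conditionals (C : markov_category) : Prop :=
  forall (A X Y : C) (f : A ~> X ⊗ Y), exists c : X ⊗ A ~> Y, is_conditional f c.

Definition atomic (C : markov_category) : Prop :=
  forall (A X : C) (p : A ~> X), atomic_morphism p.

Definition cancellative (C : markov_category) : Prop :=
  forall W : C, cancellable W.

(* What follows shows that a non-signalling morphism has a disintegration when
   conditionals exist, so that causal_trace can be defined as a function. *)

Section SymmetricMonoidalLemmas.
Context {C : symmetric_monoidal_category}.
Implicit Types A B D E : C.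

Lemma reassoc A B D E (g : B ~> D) (f : A ~> B) (k : A ~> D) :
  g ∘ f = k -> forall h : E ~> A, g ∘ (f ∘ h) = k ∘ h.
Proof. by move=> <- h; rewrite compA. Qed.

Lemma reassoc3 A B D E F (g : D ~> E) (f : B ~> D) (e : A ~> B) (k : A ~> E) :
  g ∘ (f ∘ e) = k -> forall h : F ~> A, g ∘ (f ∘ (e ∘ h)) = k ∘ h.
Proof. by move=> <- h; rewrite !compA. Qed.

Lemma reassoc4 A B D E F G (g : E ~> F) (f : D ~> E) (e : B ~> D) (d : A ~> B)
    (k : A ~> F) :
  g ∘ (f ∘ (e ∘ d)) = k -> forall h : G ~> A, g ∘ (f ∘ (e ∘ (d ∘ h))) = k ∘ h.
Proof. by move=> <- h; rewrite !compA. Qed.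

Lemma reassoc5 A B D E F G H (g : F ~> G) (f : E ~> F) (e : D ~> E)
    (d : B ~> D) (c : A ~> B) (k : A ~> G) :
  g ∘ (f ∘ (e ∘ (d ∘ c))) = k ->
  forall h : H ~> A, g ∘ (f ∘ (e ∘ (d ∘ (c ∘ h)))) = k ∘ h.
Proof. by move=> <- h; rewrite !compA. Qed.

Lemma tensm_compl A B D E (g : B ~> D) (f : A ~> B) :
  (g ∘ f) ⊗ idm E = (g ⊗ idm E) ∘ (f ⊗ idm E).
Proof. by rewrite -tensm_comp comp1m. Qed.

Lemma tensm_compr A B D E (g : B ~> D) (f : A ~> B) :
  idm E ⊗ (g ∘ f) = (idm E ⊗ g) ∘ (idm E ⊗ f).
Proof. by rewrite -tensm_comp comp1m. Qed.

Lemma tensm_exchange A B D E (f : A ~> B) (g : D ~> E) :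
  (f ⊗ idm E) ∘ (idm A ⊗ g) = (idm B ⊗ g) ∘ (f ⊗ idm D).
Proof. by rewrite -!tensm_comp !comp1m !compm1. Qed.

Lemma assocV_nat A B D A' B' D' (f : A ~> A') (g : B ~> B') (h : D ~> D') :
  assocV A' B' D' ∘ (f ⊗ (g ⊗ h)) = ((f ⊗ g) ⊗ h) ∘ assocV A B D.
Proof.
rewrite -[LHS]compm1 -(assocVK A B D) compA -(compA (assocV _ _ _)) -assoc_nat.
by rewrite compA assocK comp1m.
Qed.

Lemma assoc_epi A B D E (f g : A ⊗ (B ⊗ D) ~> E) :
  f ∘ assoc A B D = g ∘ assoc A B D -> f = g.
Proof.
by move=> h; rewrite -(compm1 f) -(compm1 g) -(assocVK A B D) !compA h.
Qed.

Lemma assocl_epi A B D E F (f g : A ⊗ (B ⊗ D) ⊗ E ~> F) :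
  f ∘ (assoc A B D ⊗ idm E) = g ∘ (assoc A B D ⊗ idm E) -> f = g.
Proof.
move=> h; rewrite -(compm1 f) -(compm1 g) -tensm1 -(assocVK A B D).
by rewrite tensm_compl !compA h.
Qed.

Lemma assoc_mono A B D E (f g : E ~> A ⊗ B ⊗ D) :
  assoc A B D ∘ f = assoc A B D ∘ g -> f = g.
Proof.
by move=> h; rewrite -(comp1m f) -(comp1m g) -(assocK A B D) -!compA h.
Qed.

Lemma tensm_unit_inj A B (f g : A ~> B) :
  idm unit_ob ⊗ f = idm unit_ob ⊗ g -> f = g.
Proof.
move=> h; rewrite -(compm1 f) -(compm1 g) -(lunitVK A) !compA.
by rewrite -!lunit_nat h.
Qed.

Lemma pentagon_r A B D E :
  assoc A B (D ⊗ E) ∘ assoc (A ⊗ B) D E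
  = (idm A ⊗ assoc B D E) ∘ (assoc A (B ⊗ D) E ∘ (assoc A B D ⊗ idm E)).
Proof. by rewrite compA pentagon. Qed.

Lemma lunit_assoc A B : lunit (A ⊗ B) ∘ assoc unit_ob A B = lunit A ⊗ idm B.
Proof.
apply: tensm_unit_inj; apply: assoc_epi; apply: assocl_epi.
rewrite -assoc_nat -[RHS]compA -tensm_compl triangle tensm_compr -!compA.
rewrite -pentagon_r compA triangle.
by rewrite -(tensm1 A B) -assoc_nat.
Qed.

Lemma lunit_swap A : runit A ∘ swap unit_ob A = lunit A.
Proof. by rewrite -swap_unit -compA swapK compm1. Qed.

Lemma hexagon_r A B D :
  (idm B ⊗ swap A D) ∘ (assoc B A D ∘ (swap A B ⊗ idm D))
  = assoc B D A ∘ (swap A (B ⊗ D) ∘ assoc A B D).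
Proof. by rewrite !compA hexagon. Qed.

Lemma hexagon_swap A B D :
  assoc A D B ∘ (swap B (A ⊗ D) ∘ (assoc B A D ∘ (swap A B ⊗ idm D)))
  = (idm A ⊗ swap B D) ∘ assoc A B D.
Proof.
by rewrite !compA hexagon -!compA -tensm_compl swapK tensm1 compm1.
Qed.

Lemma triangleV A B :
  (runit A ⊗ idm B) ∘ assocV A unit_ob B = idm A ⊗ lunit B.
Proof. by rewrite -triangle -compA assocVK compm1. Qed.

Lemma interchange_unit A B D :
  (runit A ⊗ idm (B ⊗ D)) ∘ (interchange A unit_ob B D
     ∘ (idm (A ⊗ B) ⊗ lunitV D)) = assoc A B D.
Proof.
rewrite /interchange !compA triangleV -tensm_compr !compA lunit_assoc.
rewrite -tensm_compl swap_unit triangleV -assoc_nat tensm1.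
by rewrite -compA -tensm_compr lunitVK tensm1 compm1.
Qed.

Lemma pentagonV A B D E :
  (idm A ⊗ assocV B D E) ∘ assoc A B (D ⊗ E)
  = assoc A (B ⊗ D) E ∘ ((assoc A B D ⊗ idm E) ∘ assocV (A ⊗ B) D E).
Proof.
apply: assoc_epi; rewrite -!compA assocK compm1 pentagon_r compA.
by rewrite -tensm_compr assocK tensm1 comp1m.
Qed.

Lemma swap_coherence A B D E :
  swap D (B ⊗ (A ⊗ E)) ∘ (assoc D B (A ⊗ E) ∘ (assoc (D ⊗ B) A E
    ∘ ((swap A (D ⊗ B) ⊗ idm E) ∘ ((idm A ⊗ swap B D) ⊗ idm E))))
  = ((assoc B A E ∘ (swap A B ⊗ idm E)) ⊗ idm D) ∘ (assocV (A ⊗ B) E D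
    ∘ ((idm (A ⊗ B) ⊗ swap D E) ∘ (assoc (A ⊗ B) D E
    ∘ (assocV A B D ⊗ idm E)))).
Proof.
rewrite -tensm_compl swap_nat tensm_compl (reassoc (assoc_nat _ _ _)).
rewrite tensm1 -!compA; apply: assoc_mono; apply: assocl_epi.
rewrite -!compA (reassoc4 (hexagon_swap _ _ _)) -!compA.
rewrite (reassoc (pentagon_r _ _ _ _)) -!compA -!tensm_compl -hexagon_r.
rewrite !tensm_compl (reassoc (assoc_nat _ _ _)) -!compA.
rewrite -[in RHS](tensm_compl _ (assocV A B D)) assocK tensm1 compm1.
rewrite (reassoc (eq_sym (assocV_nat _ _ _))) -!compA tensm1.
rewrite (reassoc (tensm_exchange _ _)) -!compA -[in RHS](tensm1 D E).
rewrite -[in RHS]assoc_nat.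
have hex : (idm B ⊗ swap D (A ⊗ E)) ∘ ((idm B ⊗ assoc D A E)
      ∘ (idm B ⊗ (swap A D ⊗ idm E)))
    = (idm B ⊗ assocV A E D) ∘ ((idm B ⊗ (idm A ⊗ swap D E))
      ∘ (idm B ⊗ assoc A D E)).
  rewrite -!tensm_compr; congr (_ ⊗ _); apply: assoc_mono.
  by rewrite hexagon_swap compA assocVK comp1m.
rewrite (reassoc3 hex) -!compA.
rewrite (reassoc3 (eq_sym (pentagon_r _ _ _ _))) -!compA.
rewrite (reassoc (eq_sym (assoc_nat _ _ _))) -!compA tensm1.
by rewrite (reassoc (pentagonV _ _ _ _)) -!compA.
Qed.

End SymmetricMonoidalLemmas.

Lemma interchange_nat (C : symmetric_monoidal_category)
    (A B D E A' B' D' E' : C)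
    (f : A ~> A') (g : B ~> B') (h : D ~> D') (k : E ~> E') :
  interchange A' B' D' E' ∘ ((f ⊗ h) ⊗ (g ⊗ k))
  = ((f ⊗ g) ⊗ (h ⊗ k)) ∘ interchange A B D E.
Proof.
have mid : (assoc B' D' E' ∘ (swap D' B' ⊗ idm E') ∘ assocV D' B' E')
      ∘ (h ⊗ (g ⊗ k))
    = (g ⊗ (h ⊗ k)) ∘ (assoc B D E ∘ (swap D B ⊗ idm E) ∘ assocV D B E).
  rewrite -!compA assocV_nat (reassoc (eq_sym (tensm_comp _ _ _ _))).
  rewrite swap_nat comp1m -(compm1 k) tensm_comp -!compA compm1.
  by rewrite (reassoc (assoc_nat _ _ _)) -!compA.
rewrite /interchange.
set u := assoc B' D' E' ∘ _ ∘ _ in mid *.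
set v := assoc B D E ∘ _ ∘ _ in mid *.
rewrite -!compA assoc_nat (reassoc (eq_sym (tensm_comp _ _ _ _))) mid comp1m.
rewrite -{1}(compm1 f) tensm_comp -!compA.
by rewrite (reassoc (assocV_nat _ _ _)) -!compA.
Qed.

Section Disintegration.
Context {C : markov_category}.

Lemma copy_non_signalling (X W' W : C) (fs : X ~> W) :
  ((runit W ∘ (fs ⊗ del W')) ⊗ idm (X ⊗ W')) ∘ copy (X ⊗ W')
  = assoc W X W' ∘ (((fs ⊗ idm X) ∘ copy X) ⊗ idm W').
Proof.
have copy_l : (del W' ⊗ idm W') ∘ copy W' = lunitV W'.
  by rewrite -[LHS]comp1m -lunitK -compA [lunit _ ∘ _]compA copy_lunit compm1.
rewrite copy_tens tensm_compl -[LHS]compA -{2}(tensm1 X W').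
rewrite (reassoc (eq_sym (interchange_nat _ _ _ _))) -[X in _ ∘ X]compA.
rewrite -tensm_comp copy_l.
rewrite -{1}[lunitV W']compm1 -[in LHS](comp1m (_ ∘ copy X)) tensm_comp.
exact: reassoc3 (interchange_unit _ _ _) _.
Qed.

Lemma non_signalling_disintegration (hC : has_conditionals C)
    (X W' Y W : C) (f : X ⊗ W' ~> Y ⊗ W) :
  non_signalling f -> exists fs fp, is_disintegration f fs fp.
Proof.
case=> fs hfs; have [c hc] := hC _ _ _ (swap Y W ∘ f).
have marg : runit W ∘ (idm W ⊗ del Y) ∘ (swap Y W ∘ f)
    = runit W ∘ (fs ⊗ del W').
  rewrite -hfs -!compA (reassoc (eq_sym (swap_nat _ _))) -!compA.
  by rewrite compA lunit_swap.
have {}hc : swap Y W ∘ f = (idm W ⊗ c) ∘ (assoc W W (X ⊗ W')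
    ∘ ((copy W ⊗ idm (X ⊗ W')) ∘ (assoc W X W'
    ∘ (((fs ⊗ idm X) ∘ copy X) ⊗ idm W')))).
  by rewrite {1}hc marg -!compA copy_non_signalling.
exists fs, (c ∘ (assoc W X W' ∘ (swap X W ⊗ idm W'))).
rewrite /is_disintegration /copied_marginal.
have -> : f = swap W Y ∘ (swap Y W ∘ f) by rewrite compA swapK comp1m.
set M := (idm X ⊗ (copy W ∘ fs)) ∘ copy X.
have ME : (copy W ⊗ idm X) ∘ ((fs ⊗ idm X) ∘ copy X)
    = swap X (W ⊗ W) ∘ ((idm X ⊗ swap W W) ∘ M).
  rewrite /M (compA (idm X ⊗ swap W W)) -tensm_compr (compA (swap W W)).
  rewrite copy_comm (compA (swap X _)) swap_nat -compA copy_comm.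
  by rewrite compA -tensm_compl.
have -> : assocV X W W ∘ (idm X ⊗ (copy W ∘ fs)) ∘ copy X = assocV X W W ∘ M.
  by rewrite -compA.
rewrite hc (compA (swap W Y)) swap_nat -(tensm1 X W').
rewrite (compA (copy W ⊗ _)) -assoc_nat -!compA -tensm_compl ME !tensm_compl.
have := reassoc5 (swap_coherence X W W W') (M ⊗ idm W').
by rewrite -!compA !tensm_compl -!compA => ->.
Qed.

Lemma traceable_causal_trace (hC : has_conditionals C) (X W Y : C)
    (f : X ⊗ W ~> Y ⊗ W) :
  traceable f -> exists t, is_causal_trace f t.
Proof.
move=> /(non_signalling_disintegration hC) [fs [fp hf]].
by exists (fp ∘ copied_marginal fs), fs, fp.
Qed.

(* fp ∘ s for an arbitrarily chosen disintegration (fs, fp) of f: nothing is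
   known about the choice, so that it does not matter has to be derived from
   cancellativity and atomicity. *)
Definition causal_trace (hC : has_conditionals C) (X W Y : C)
    (f : X ⊗ W ~> Y ⊗ W) (hf : traceable f) : X ~> Y :=
  proj1_sig (constructive_indefinite_description (is_causal_trace f)
               (traceable_causal_trace hC hf)).

End Disintegration.

(* Main.v *)
(* Write a disintegration as f = (f_p, w), where w is sampled from f_s(x) and
   f_p reads (x, w, w').  Both causal traces equal "sample w, return
   f_p(x, w, g w)".  For f ∘ (id ⊗ g) this is the disintegration
   (f_s, f_p ∘ (id ⊗ g)); for (id ⊗ g) ∘ f one takes g ∘ f_s and lets f_p read a
   w resampled from (x, g w) by a conditional.
   It remains to see that the trace does not depend on the disintegration:
   cancellability of W determines f_s, and f determines f_p up to almost sure
   equality along q = (x, f_s(x)); read with w' taken from a second copy of q,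
   this is an equality along q ⊗ q, which atomicity carries to the diagonal
   copy ∘ q. *)
Require Import Defs.
From Stdlib Require Import ssreflect IndefiniteDescription.

Set Implicit Arguments.
Unset Strict Implicit.
Unset Printing Implicit Defensive.

(** * Coherence of unitors with the interchange *)

(** Tensoring with the unit is faithful, and after it the pentagon and the triangle give the
    identity. *)
Lemma runit_assoc (C : symmetric_monoidal_category) (A B : C) :
  (idm A ⊗ runit B) ∘ assoc A B unit_ob = runit (A ⊗ B).
Proof.
have runit_inj D E (f g : D ~> E) :
    f ⊗ idm (@unit_ob C) = g ⊗ idm unit_ob -> f = g.
  move=> h; rewrite -(compm1 f) -(compm1 g) -(runitVK D) !compA.
  by rewrite -!runit_nat h.
apply: runit_inj; apply: assoc_mono.
rewrite tensm_compl (reassoc (assoc_nat _ _ _)) -!compA -triangle tensm_compr.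
rewrite -!compA -pentagon_r (reassoc (eq_sym (assoc_nat _ _ _))) tensm1.
by rewrite -compA triangle.
Qed.

Lemma interchange_runit (C : symmetric_monoidal_category) (A B : C) :
  (runit A ⊗ runit B) ∘ (interchange A unit_ob B unit_ob
    ∘ (idm (A ⊗ B) ⊗ lunitV unit_ob)) = runit (A ⊗ B).
Proof.
have -> : runit A ⊗ runit B = (idm A ⊗ runit B) ∘ (runit A ⊗ idm (B ⊗ unit_ob)).
  by rewrite -tensm_comp comp1m compm1.
by rewrite -compA interchange_unit runit_assoc.
Qed.

Lemma interchange_lunit (C : symmetric_monoidal_category) (A B : C) :
  (lunit A ⊗ lunit B) ∘ (interchange unit_ob A unit_ob B
    ∘ (lunitV unit_ob ⊗ idm (A ⊗ B))) = lunit (A ⊗ B).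
Proof.
have lunit_assocV (D E : C) : (lunit D ⊗ idm E) ∘ assocV unit_ob D E = lunit (D ⊗ E).
  by rewrite -lunit_assoc -compA assocVK compm1.
have -> : lunit A ⊗ lunit B = (idm A ⊗ lunit B) ∘ (lunit A ⊗ idm (unit_ob ⊗ B)).
  by rewrite -tensm_comp comp1m compm1.
rewrite /interchange -!compA (reassoc (lunit_assocV _ _)).
rewrite (reassoc (lunit_nat _)) -!compA (reassoc (lunit_assoc _ _)).
rewrite -tensm_comp lunitVK comp1m tensm1 compm1.
rewrite (compA _ (assoc _ _ _)) triangle (compA (_ ⊗ _)) -tensm_comp comp1m.
by rewrite lunit_swap lunit_assocV.
Qed.

(** * Calculus of pairings and projections *)

Section Pairing.
Context {C : markov_category}.
Implicit Types A B D E X Y Z : C.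

(* Locked because [rewrite -!compA] would unfold them to reach the compositions
   inside. *)
Definition pairm A X Y (f : A ~> X) (g : A ~> Y) : A ~> X ⊗ Y :=
  locked ((f ⊗ g) ∘ copy A).
Definition fstm X Y : X ⊗ Y ~> X := locked (runit X ∘ (idm X ⊗ del Y)).
Definition sndm X Y : X ⊗ Y ~> Y := locked (lunit Y ∘ (del X ⊗ idm Y)).

Local Notation "⟨ f , g ⟩" := (pairm f g) (at level 0) : mor_scope.
Local Notation π1 := (fstm _ _).
Local Notation π2 := (sndm _ _).

Lemma pairE A X Y (f : A ~> X) (g : A ~> Y) : ⟨f, g⟩ = (f ⊗ g) ∘ copy A.
Proof. by rewrite /pairm -lock. Qed.

Lemma fstE X Y : fstm X Y = runit X ∘ (idm X ⊗ del Y).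
Proof. by rewrite /fstm -lock. Qed.

Lemma sndE X Y : sndm X Y = lunit Y ∘ (del X ⊗ idm Y).
Proof. by rewrite /sndm -lock. Qed.

(** These are the morphisms along which [copy] is natural; a random morphism cannot in general be
    moved inside a pairing. *)
Definition deterministic A X (f : A ~> X) : Prop :=
  copy X ∘ f = ⟨f, f⟩.

Lemma unit_uniq A (f : A ~> unit_ob) : f = del A.
Proof. by rewrite -(del_nat f) del_unit comp1m. Qed.

Lemma fst_pair A X Y (f : A ~> X) (g : A ~> Y) : π1 ∘ ⟨f, g⟩ = f.
Proof.
rewrite !pairE fstE -compA (compA _ _ (copy A)) -tensm_comp del_nat comp1m.
rewrite -{1}(compm1 f) -{1}(comp1m (del A)) tensm_comp -compA compA.
by rewrite runit_nat -!compA [X in _ ∘ X]compA copy_runit compm1.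
Qed.

Lemma snd_pair A X Y (f : A ~> X) (g : A ~> Y) : π2 ∘ ⟨f, g⟩ = g.
Proof.
rewrite !pairE sndE -compA (compA _ _ (copy A)) -tensm_comp del_nat comp1m.
rewrite -{1}(compm1 g) -{1}(comp1m (del A)) tensm_comp -compA compA.
by rewrite lunit_nat -!compA [X in _ ∘ X]compA copy_lunit compm1.
Qed.

Lemma tensm_pair A X Y X' Y' (h : X ~> X') (k : Y ~> Y')
    (f : A ~> X) (g : A ~> Y) :
  (h ⊗ k) ∘ ⟨f, g⟩ = ⟨h ∘ f, k ∘ g⟩.
Proof. by rewrite !pairE compA -tensm_comp. Qed.

Lemma swap_pair A X Y (f : A ~> X) (g : A ~> Y) :
  swap X Y ∘ ⟨f, g⟩ = ⟨g, f⟩.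
Proof. by rewrite !pairE compA swap_nat -compA copy_comm. Qed.

Lemma assoc_pair A X Y Z (f : A ~> X) (g : A ~> Y) (h : A ~> Z) :
  assoc X Y Z ∘ ⟨⟨f, g⟩, h⟩ = ⟨f, ⟨g, h⟩⟩.
Proof.
rewrite !pairE -{1}(compm1 h) tensm_comp compA (compA (assoc _ _ _)) assoc_nat.
rewrite -{2}(compm1 f) tensm_comp -!compA; congr (_ ∘ _).
by rewrite -copy_assoc -compA.
Qed.

Lemma assocV_pair A X Y Z (f : A ~> X) (g : A ~> Y) (h : A ~> Z) :
  assocV X Y Z ∘ ⟨f, ⟨g, h⟩⟩ = ⟨⟨f, g⟩, h⟩.
Proof. by rewrite -assoc_pair compA assocK comp1m. Qed.

Lemma interchange_pair A X Y X' Y'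
    (f : A ~> X) (g : A ~> Y) (f' : A ~> X') (g' : A ~> Y') :
  interchange X Y X' Y' ∘ ⟨⟨f, f'⟩, ⟨g, g'⟩⟩ = ⟨⟨f, g⟩, ⟨f', g'⟩⟩.
Proof.
rewrite /interchange -!compA assoc_pair tensm_pair -!compA assocV_pair.
by rewrite tensm_pair swap_pair assoc_pair !comp1m assocV_pair.
Qed.

Lemma pair_comp_det A B X Y (f : A ~> X) (g : A ~> Y) (d : B ~> A) :
  deterministic d -> ⟨f, g⟩ ∘ d = ⟨f ∘ d, g ∘ d⟩.
Proof. by move=> hd; rewrite !pairE -compA hd !pairE tensm_comp compA. Qed.

Lemma copyE A : copy A = ⟨idm A, idm A⟩.
Proof. by rewrite !pairE tensm1 comp1m. Qed.

Lemma deterministic_comp A B D (f : B ~> D) (g : A ~> B) :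
  deterministic f -> deterministic g -> deterministic (f ∘ g).
Proof.
rewrite /deterministic => hf hg.
by rewrite compA hf pairE -compA hg tensm_pair.
Qed.

Lemma deterministic_id A : deterministic (idm A).
Proof. by rewrite /deterministic compm1 copyE. Qed.

Lemma deterministic_pair A X Y (f : A ~> X) (g : A ~> Y) :
  deterministic f -> deterministic g -> deterministic ⟨f, g⟩.
Proof.
move=> hf hg; rewrite /deterministic copy_tens -compA tensm_pair hf hg.
exact: interchange_pair.
Qed.

Lemma del_copy A : (del A ⊗ del A) ∘ copy A = lunitV unit_ob ∘ del A.
Proof.
rewrite -[LHS]comp1m -lunitK -compA; congr (_ ∘ _); exact: unit_uniq.
Qed.

Lemma copy_delr A : (idm A ⊗ del A) ∘ copy A = runitV A.
Proof. by rewrite -[LHS]comp1m -runitK -compA [runit _ ∘ _]compA copy_runit compm1. Qed.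

Lemma copy_dell A : (del A ⊗ idm A) ∘ copy A = lunitV A.
Proof. by rewrite -[LHS]comp1m -lunitK -compA [lunit _ ∘ _]compA copy_lunit compm1. Qed.

(** Discarding both copies of [Y] leaves only unit wires, which the unitors absorb through the
    interchange. *)
Lemma deterministic_fst X Y : deterministic (fstm X Y).
Proof.
rewrite /deterministic !pairE copy_tens {2 3}fstE tensm_comp.
rewrite -(compA _ _ (interchange _ _ _ _ ∘ _)).
rewrite (reassoc (eq_sym (interchange_nat _ _ _ _))).
rewrite -(compA (interchange _ _ _ _)) -tensm_comp.
rewrite del_copy tensm1 comp1m.
rewrite -{2}(comp1m (copy X)) tensm_comp.
rewrite (reassoc3 (interchange_runit _ _)) fstE.
rewrite -{2}(comp1m (del Y)) -{2}(compm1 (copy X)) tensm_comp.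
by rewrite (compA (runit _)) runit_nat -!compA.
Qed.

Lemma deterministic_snd X Y : deterministic (sndm X Y).
Proof.
rewrite /deterministic !pairE copy_tens {2 3}sndE tensm_comp.
rewrite -(compA _ _ (interchange _ _ _ _ ∘ _)).
rewrite (reassoc (eq_sym (interchange_nat _ _ _ _))).
rewrite -(compA (interchange _ _ _ _)) -tensm_comp.
rewrite del_copy tensm1 comp1m.
rewrite -{2}(comp1m (copy Y)) tensm_comp.
rewrite (reassoc3 (interchange_lunit _ _)) sndE.
rewrite -{2}(comp1m (del X)) -{2}(compm1 (copy Y)) tensm_comp.
by rewrite (compA (lunit _)) lunit_nat -!compA.
Qed.

#[local] Hint Resolve deterministic_id deterministic_fst deterministic_snd
  deterministic_pair deterministic_comp : det.

(** Copying a tensor duplicates both factors and the projections discard one duplicate of each, so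
    the counit laws apply. *)
Lemma pair_fst_snd X Y : ⟨fstm X Y, sndm X Y⟩ = idm (X ⊗ Y).
Proof.
rewrite !pairE fstE sndE copy_tens tensm_comp.
rewrite -(compA _ _ (interchange _ _ _ _ ∘ _)).
rewrite (reassoc (eq_sym (interchange_nat _ _ _ _))).
rewrite -(compA (interchange _ _ _ _)) -tensm_comp.
rewrite copy_delr copy_dell.
have -> : runit X ⊗ lunit Y = (idm X ⊗ lunit Y) ∘ (runit X ⊗ idm _).
  by rewrite -tensm_comp comp1m compm1.
have -> : runitV X ⊗ lunitV Y = (idm _ ⊗ lunitV Y) ∘ (runitV X ⊗ idm _).
  by rewrite -tensm_comp comp1m compm1.
rewrite -compA (reassoc3 (interchange_unit _ _ _)) compA triangle.
by rewrite -tensm_comp runitVK comp1m tensm1.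
Qed.

Lemma tensmE X Y X' Y' (f : X ~> X') (g : Y ~> Y') : f ⊗ g = ⟨f ∘ π1, g ∘ π2⟩.
Proof. by rewrite -tensm_pair pair_fst_snd compm1. Qed.

Lemma fst_tensm X Y X' Y' (f : X ~> X') (g : Y ~> Y') : π1 ∘ (f ⊗ g) = f ∘ π1.
Proof. by rewrite tensmE fst_pair. Qed.

Lemma snd_tensm X Y X' Y' (f : X ~> X') (g : Y ~> Y') : π2 ∘ (f ⊗ g) = g ∘ π2.
Proof. by rewrite tensmE snd_pair. Qed.

(* [q] may be random: its output is not duplicated, only the other wire is. *)
Lemma pair_tensm_snd X Y Z D E (q : X ~> D) (k : D ⊗ Y ~> Z) (d : Y ~> E) :
  ⟨k ∘ (q ⊗ idm Y), d ∘ π2⟩ = ⟨k, d ∘ π2⟩ ∘ (q ⊗ idm Y).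
Proof.
have copied A (r : A ~> D) : ⟨r ⊗ idm Y, sndm A Y⟩ = assocV D Y Y ∘ (r ⊗ copy Y).
  rewrite !tensmE copyE pair_comp_det; first exact: deterministic_snd.
  by rewrite !comp1m assocV_pair.
have -> : ⟨k, d ∘ π2⟩ = (k ⊗ d) ∘ ⟨idm D ⊗ idm Y, sndm D Y⟩.
  by rewrite tensm_pair tensm1 compm1.
rewrite -tensm_pair !copied -!compA -tensm_comp.
by rewrite comp1m compm1.
Qed.

Lemma pair_tensm_fst X Y Z D E (q : Y ~> D) (k : X ⊗ D ~> Z) (d : X ~> E) :
  ⟨k ∘ (idm X ⊗ q), d ∘ π1⟩ = ⟨k, d ∘ π1⟩ ∘ (idm X ⊗ q).
Proof.
have copied A (r : A ~> D) :
    ⟨idm X ⊗ r, fstm X A⟩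
    = swap X (X ⊗ D) ∘ (assoc X X D ∘ (copy X ⊗ r)).
  rewrite !tensmE copyE pair_comp_det; first exact: deterministic_fst.
  by rewrite !comp1m assoc_pair swap_pair.
have -> : ⟨k, d ∘ π1⟩ = (k ⊗ d) ∘ ⟨idm X ⊗ idm D, fstm X D⟩.
  by rewrite tensm_pair tensm1 compm1.
rewrite -tensm_pair !copied -!compA -tensm_comp.
by rewrite comp1m compm1.
Qed.

Lemma pair_comp_fst X Y Z D (f : X ~> Z) (g : X ~> D) :
  ⟨f, g⟩ ∘ fstm X Y = ⟨f ∘ π1, g ∘ π1⟩.
Proof. exact/pair_comp_det/deterministic_fst. Qed.

Lemma pair_comp_snd X Y Z D (f : Y ~> Z) (g : Y ~> D) :
  ⟨f, g⟩ ∘ sndm X Y = ⟨f ∘ π2, g ∘ π2⟩.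
Proof. exact/pair_comp_det/deterministic_snd. Qed.

(** * Graphs, disintegrations and causal traces as pairings *)

Definition graph X W (h : X ~> W) : X ~> X ⊗ W := ⟨idm X, h⟩.

Lemma copied_marginalE X W (fs : X ~> W) :
  copied_marginal fs = ⟨idm _, π2⟩ ∘ graph fs.
Proof.
rewrite /copied_marginal /graph tensm_compr -!compA -pairE -(pair_fst_snd X W).
rewrite compA tensmE copyE pair_comp_snd !comp1m.
by rewrite assocV_pair.
Qed.

Lemma disintegrationE X W' Y W (f : X ⊗ W' ~> Y ⊗ W) fs fp :
  is_disintegration f fs fp <->
  f = ⟨fp, π2 ∘ π1⟩ ∘ (graph fs ⊗ idm W').
Proof.
rewrite /is_disintegration copied_marginalE tensm_compl.
have -> : ⟨fp, π2 ∘ π1⟩ = (fp ⊗ idm W) ∘ assocV (X ⊗ W) W' W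
    ∘ (idm (X ⊗ W) ⊗ swap W W') ∘ assoc (X ⊗ W) W W'
    ∘ (⟨idm _, π2⟩ ⊗ idm W').
  rewrite (tensmE ⟨_, _⟩) pair_comp_fst !comp1m -!compA.
  rewrite assoc_pair tensm_pair swap_pair comp1m assocV_pair pair_fst_snd.
  by rewrite tensm_pair compm1 comp1m.
by rewrite -!compA.
Qed.

Lemma causal_traceE X W Y (f : X ⊗ W ~> Y ⊗ W) t :
  is_causal_trace f t <->
  exists fs fp, f = ⟨fp, π2 ∘ π1⟩ ∘ (graph fs ⊗ idm W)
    /\ t = fp ∘ (⟨idm _, π2⟩ ∘ graph fs).
Proof.
by split=> -[fs [fp [/disintegrationE hf ->]]]; exists fs, fp; rewrite copied_marginalE.
Qed.

Lemma snd_disintegration X W' Y W (fs : X ~> W) (fp : X ⊗ W ⊗ W' ~> Y) :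
  π2 ∘ (⟨fp, π2 ∘ π1⟩ ∘ (graph fs ⊗ idm W')) = fs ∘ π1.
Proof. by rewrite compA snd_pair -compA fst_tensm compA snd_pair. Qed.

Lemma causal_trace_traceable X W Y (f : X ⊗ W ~> Y ⊗ W) t :
  is_causal_trace f t -> traceable f.
Proof.
move=> /causal_traceE [fs [fp [hf _]]]; exists fs.
rewrite -sndE hf snd_disintegration -{2}(compm1 fs) -(comp1m (del W)).
by rewrite tensm_comp compA runit_nat fstE compA.
Qed.

(** Up to swaps and a unitor, [f ∘ fstm A W] is [del W ⊗ f]. *)
Lemma cancel_fst W : cancellable W -> forall A B (f1 f2 : A ~> B),
  f1 ∘ fstm A W = f2 ∘ fstm A W -> f1 = f2.
Proof.
move=> hW A B f1 f2 h; apply: hW.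
have E (f : A ~> B) : del W ⊗ f = swap _ _ ∘ (runitV B ∘ (f ∘ fstm A W)) ∘ swap W A.
  rewrite fstE (compA f) -runit_nat -!compA (compA (runitV B)) runitK comp1m.
  rewrite (compA (f ⊗ _)) -tensm_comp comp1m compm1 compA swap_nat -compA.
  by rewrite swapK compm1.
by rewrite !E h.
Qed.

Definition swap_right X Y Z : X ⊗ Y ⊗ Z ~> X ⊗ Z ⊗ Y :=
  locked (assocV X Z Y ∘ ((idm X ⊗ swap Y Z) ∘ assoc X Y Z)).

Lemma swap_right_pair A X Y Z (f : A ~> X) (g : A ~> Y) (h : A ~> Z) :
  swap_right X Y Z ∘ ⟨⟨f, g⟩, h⟩ = ⟨⟨f, h⟩, g⟩.
Proof.
by rewrite /swap_right -lock -!compA assoc_pair tensm_pair swap_pair comp1m assocV_pair.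
Qed.

Lemma swap_rightE X Y Z : swap_right X Y Z = ⟨⟨π1 ∘ π1, π2⟩, π2 ∘ π1⟩.
Proof.
rewrite -[LHS]compm1 -pair_fst_snd -{1}(comp1m (fstm (X ⊗ Y) Z)) -pair_fst_snd.
by rewrite pair_comp_fst swap_right_pair.
Qed.

(* [graph h] keeps its input, so [d] can be read after it. *)
Lemma pair_graph A B Z D (h : A ~> B) (k : A ⊗ B ~> Z) (d : A ~> D) :
  ⟨k ∘ graph h, d⟩ = ⟨k, d ∘ π1⟩ ∘ graph h.
Proof.
have copied : ⟨graph h, idm A⟩ = ⟨idm (A ⊗ B), π1⟩ ∘ graph h.
  rewrite /graph -swap_right_pair -copyE.
  have -> : ⟨copy A, h⟩ = (copy A ⊗ idm B) ∘ ⟨idm A, h⟩.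
    by rewrite tensm_pair compm1 comp1m.
  rewrite compA; congr (_ ∘ _).
  rewrite tensmE copyE pair_comp_fst !comp1m swap_right_pair.
  by rewrite pair_fst_snd.
rewrite -{1}(compm1 d) -tensm_pair copied compA tensm_pair.
by rewrite compm1.
Qed.

(** Carrying [W'] along gives again a graph, up to a permutation of wires; this brings [pair_graph]
    into play. *)
Lemma graph_tensm X W W' (h : X ~> W) :
  graph h ⊗ idm W' = swap_right X W' W ∘ graph (h ∘ π1).
Proof.
rewrite /graph -(pair_fst_snd X W') swap_right_pair tensmE pair_comp_fst.
by rewrite !comp1m.
Qed.

Lemma pair_graph_tensm X W W' Z (h : X ~> W) (k : X ⊗ W ⊗ W' ~> Z) :
  ⟨k ∘ (graph h ⊗ idm W'), π1⟩ = ⟨k, π1 ∘ π1⟩ ∘ (graph h ⊗ idm W').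
Proof.
rewrite graph_tensm !compA pair_graph [in RHS]pair_comp_det.
  by rewrite swap_rightE; auto with det.
by rewrite swap_rightE -(compA π1) !fst_pair.
Qed.

(** The right side mentions only [f]: its output already contains [w], and the retained input
    supplies [x]. Hence [f] determines [fp] almost surely along the graph. *)
Lemma disintegration_input X W' Y W (f : X ⊗ W' ~> Y ⊗ W) fs fp :
  f = ⟨fp, π2 ∘ π1⟩ ∘ (graph fs ⊗ idm W') ->
  ⟨fp, π1⟩ ∘ (graph fs ⊗ idm W')
  = ((idm Y ⊗ swap W X) ∘ assoc Y W X) ∘ ⟨f, π1⟩.
Proof.
move=> ->; rewrite pair_graph_tensm compA -(compA _ _ ⟨_, _⟩) assoc_pair.
rewrite tensm_pair swap_pair comp1m -pair_comp_fst pair_fst_snd.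
by rewrite comp1m.
Qed.

(** * Almost sure equality and uniqueness of the causal trace *)

Lemma aseE A V X Y (p : A ~> X) (f1 f2 : V ⊗ X ~> Y) :
  ase p f1 f2 <-> ⟨f1, π2⟩ ∘ (idm V ⊗ p) = ⟨f2, π2⟩ ∘ (idm V ⊗ p).
Proof.
have E (f : V ⊗ X ~> Y) : (f ⊗ idm X) ∘ assocV V X X ∘ (idm V ⊗ (copy X ∘ p))
    = ⟨f, π2⟩ ∘ (idm V ⊗ p).
  rewrite tensm_compr compA; congr (_ ∘ _).
  rewrite copyE (tensmE _ ⟨_, _⟩) pair_comp_snd !comp1m -compA.
  by rewrite assocV_pair pair_fst_snd tensm_pair comp1m compm1.
by rewrite /ase !E.
Qed.

Lemma snd_lunitV X : sndm unit_ob X ∘ lunitV X = idm X.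
Proof. by rewrite sndE del_unit tensm1 compm1 lunitVK. Qed.

Lemma disintegration_trace_uniq X W Y (f : X ⊗ W ~> Y ⊗ W) fs fp gs gp :
  cancellative C -> atomic C ->
  f = ⟨fp, π2 ∘ π1⟩ ∘ (graph fs ⊗ idm W) ->
  f = ⟨gp, π2 ∘ π1⟩ ∘ (graph gs ⊗ idm W) ->
  fp ∘ (⟨idm _, π2⟩ ∘ graph fs) = gp ∘ (⟨idm _, π2⟩ ∘ graph gs).
Proof.
move=> hcanc hatom hf hg.
have eqs : fs = gs.
  apply: (cancel_fst (hcanc W)).
  by rewrite -(snd_disintegration _ fp) -hf hg snd_disintegration.
move: hg; rewrite -{}eqs => hg {gs}.
set q := graph fs in hf hg *.
have eqp : ⟨fp, π1⟩ ∘ (q ⊗ idm W) = ⟨gp, π1⟩ ∘ (q ⊗ idm W).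
  by rewrite (disintegration_input hf) (disintegration_input hg).
(* [F p] takes its last argument from a second sample of [q], ignoring the [X] part of that
   sample. *)
pose F (p : X ⊗ W ⊗ W ~> Y) := p ∘ (idm (X ⊗ W) ⊗ sndm X W).
have diag p : F p ∘ copy (X ⊗ W) = p ∘ ⟨idm _, π2⟩.
  by rewrite /F -compA copyE tensm_pair compm1 compm1.
(* Drawing the second sample first isolates [p] inside [⟨p, π1⟩ ∘ (q ⊗ idm W)], which [eqp]
   controls. *)
have FE p : ⟨F p, idm _⟩ ∘ (q ⊗ q)
    = assoc _ _ _ ∘ ⟨⟨p, π1⟩ ∘ (q ⊗ idm W) ∘ (idm X ⊗ π2), π2⟩ ∘ (idm X ⊗ q).
  rewrite -{1}(compm1 q) -{2}(comp1m q) tensm_comp compA; congr (_ ∘ _).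
  rewrite -compA tensm_exchange compA -{1}(comp1m (sndm _ (X ⊗ W))) pair_tensm_snd.
  rewrite compA comp1m; congr (_ ∘ _).
  rewrite pair_comp_det; last by rewrite fst_tensm comp1m assoc_pair pair_fst_snd.
  by rewrite tensmE comp1m; auto with det.
clearbody F.
(* No extra input is needed, so the parameter wire of [ase] is the unit object. *)
have key : ase (q ⊗ q) (F fp ∘ sndm unit_ob _) (F gp ∘ sndm unit_ob _).
  apply/aseE.
  have E p : ⟨F p ∘ sndm unit_ob _, sndm unit_ob _⟩ ∘ (idm unit_ob ⊗ (q ⊗ q))
      = ⟨F p, idm _⟩ ∘ (q ⊗ q) ∘ π2.
    rewrite -compA -(snd_tensm (idm unit_ob) (q ⊗ q)) compA pair_comp_snd.
    by rewrite comp1m.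
  by rewrite !E !FE eqp.
have /aseE := hatom _ _ q _ _ _ _ key.
(* Dropping the retained samples and the unit wire leaves [F p ∘ copy _ ∘ q], which [diag] turns
   into the trace formula. *)
move/(f_equal (fun h => π1 ∘ h ∘ lunitV X)).
rewrite !(compA π1) !fst_pair -!compA !(compA π2) !snd_tensm.
by rewrite -!(compA _ π2) snd_lunitV compm1 !(compA (F _)) !diag -!compA.
Qed.

Lemma causal_trace_uniq X W Y (f : X ⊗ W ~> Y ⊗ W) t u :
  cancellative C -> atomic C ->
  is_causal_trace f t -> is_causal_trace f u -> t = u.
Proof.
move=> hcanc hatom /causal_traceE [fs [fp [hf ->]]].
by move=> /causal_traceE [gs [gp [hg ->]]]; exact: disintegration_trace_uniq hf hg.
Qed.

(** * Causal traces of the two composites *)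

Lemma causal_trace_precomp X W W' Y (fs : X ~> W) (fp : X ⊗ W ⊗ W' ~> Y)
    (g : W ~> W') :
  is_causal_trace
    (⟨fp, π2 ∘ π1⟩ ∘ (graph fs ⊗ idm W') ∘ (idm X ⊗ g))
    (fp ∘ (⟨idm _, g ∘ π2⟩ ∘ graph fs)).
Proof.
apply/causal_traceE; exists fs, (fp ∘ (idm _ ⊗ g)); split.
  by rewrite -compA tensm_exchange pair_tensm_fst compA.
by rewrite -compA (compA (_ ⊗ _)) tensm_pair comp1m.
Qed.

(* Bayesian inversion: [κ] keeps [x] and resamples [w] given [g w] and [x]. *)
Lemma graph_bayes X W W' (fs : X ~> W) (g : W ~> W') :
  has_conditionals C ->
  exists κ : X ⊗ W' ~> X ⊗ W,
    ⟨κ, π2⟩ ∘ graph (g ∘ fs) = ⟨idm _, g ∘ π2⟩ ∘ graph fs.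
Proof.
move=> hcond; have [k hk] := hcond _ _ _ (⟨g, idm W⟩ ∘ fs).
(* The conditional [k] of the joint law of [(g w, w)] expects [W'] before [X], hence the swap. *)
exists ⟨π1, k ∘ swap X W'⟩.
have {}hk : ⟨g, idm W⟩ ∘ fs = ⟨π1, k⟩ ∘ ⟨g ∘ fs, idm X⟩.
  rewrite [LHS]hk -fstE (compA π1) fst_pair -!compA -pairE.
  rewrite (compA (assoc _ _ _)) compA; congr (_ ∘ _).
  rewrite (tensmE (copy _)) copyE pair_comp_fst !comp1m assoc_pair.
  by rewrite tensm_pair pair_fst_snd compm1 comp1m.
have swap_det : deterministic (swap X W').
  by rewrite -(compm1 (swap _ _)) -pair_fst_snd swap_pair; auto with det.
(* The equation of the conditional forgets [x]; since both graphs keep it, [pair_graph] adds it to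
   each side. *)
have {hk} : ⟨⟨g ∘ π2, π2⟩, π1⟩ ∘ graph fs
    = ⟨⟨π2, k ∘ swap X W'⟩, π1⟩ ∘ graph (g ∘ fs).
  have gE : ⟨g ∘ fs, idm X⟩ = swap X W' ∘ graph (g ∘ fs) by rewrite swap_pair.
  have swapE : fstm W' X ∘ swap X W' = π2.
    by rewrite -(compm1 (swap _ _)) -{1}pair_fst_snd swap_pair fst_pair.
  rewrite -(comp1m (fstm X W)) -(comp1m (fstm X W')) -swapE -pair_comp_det //.
  rewrite -{2}(comp1m (sndm X W)) -pair_comp_snd -!pair_graph.
  by rewrite -!compA -gE -hk snd_pair.
move/(f_equal (fun h =>
  assocV X W W' ∘ ((idm X ⊗ swap W' W) ∘ (swap (W' ⊗ W) X ∘ h)))).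
have wires D (a : D ~> X) (b : D ~> W) (c : D ~> W') Z (h : Z ~> D) :
    assocV X W W' ∘ ((idm X ⊗ swap W' W) ∘ (swap (W' ⊗ W) X
      ∘ (⟨⟨c, b⟩, a⟩ ∘ h))) = ⟨⟨a, b⟩, c⟩ ∘ h.
  rewrite (compA (swap _ X)) swap_pair (compA (_ ⊗ _)) tensm_pair swap_pair.
  by rewrite compA comp1m assocV_pair.
by rewrite !wires pair_fst_snd => ->.
Qed.

Lemma causal_trace_postcomp X W W' Y (fs : X ~> W) (fp : X ⊗ W ⊗ W' ~> Y)
    (g : W ~> W') :
  has_conditionals C ->
  is_causal_trace
    ((idm Y ⊗ g) ∘ (⟨fp, π2 ∘ π1⟩ ∘ (graph fs ⊗ idm W')))
    (fp ∘ (⟨idm _, g ∘ π2⟩ ∘ graph fs)).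
Proof.
move=> hcond; have [κ hκ] := graph_bayes fs g hcond.
(* The composite depends on [a] and [b] only through [⟨a, b⟩], the shape in which [hκ] can be
   used. *)
have wires D (a : D ~> X ⊗ W) (b : D ~> W') :
    ⟨fp ∘ (a ⊗ idm W'), b ∘ π1⟩
    = (fp ⊗ idm W') ∘ (swap_right (X ⊗ W) W' W' ∘ (⟨a, b⟩ ⊗ idm W')).
  rewrite (tensmE ⟨_, _⟩) pair_comp_fst swap_right_pair tensm_pair.
  by rewrite (comp1m (b ∘ _)) -tensmE.
apply/causal_traceE; exists (g ∘ fs), (fp ∘ (κ ⊗ idm W')); split.
  rewrite compA tensm_pair comp1m -[fp in LHS]compm1 -tensm1.
  rewrite (compA g) !wires // -!compA -!tensm_compl.
  by rewrite hκ.
(* On the diagonal the new [f_p] reads [⟨κ, π2⟩], so [hκ] also evaluates the trace. *)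
rewrite -compA (compA (_ ⊗ _)) tensm_pair compm1 comp1m.
by rewrite hκ.
Qed.

End Pairing.

Theorem proposition19 (C : markov_category)
  (hcanc : cancellative C) (hatom : atomic C) (hcond : has_conditionals C)
  (X Y W W' : C) (f : X ⊗ W' ~> Y ⊗ W) (g : W ~> W')
  (hf : non_signalling f) :
  exists (h1 : traceable ((idm Y ⊗ g) ∘ f)) (h2 : traceable (f ∘ (idm X ⊗ g))),
    causal_trace hcond h1 = causal_trace hcond h2.
Proof.
have [fs [fp /disintegrationE hd]] := non_signalling_disintegration hcond hf.
(* Both composites receive the same explicit trace; uniqueness then transfers the equality to the
   chosen ones. *)
have t1 := causal_trace_postcomp fs fp g hcond.
have t2 := causal_trace_precomp fs fp g.
rewrite -hd in t1 t2.
exists (causal_trace_traceable t1), (causal_trace_traceable t2).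
rewrite /causal_trace.
case: constructive_indefinite_description => t ht.
case: constructive_indefinite_description => u hu /=.
rewrite (causal_trace_uniq hcanc hatom ht t1).
exact: causal_trace_uniq t2 hu.
Qed.
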